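(* Let $\mathbb F$ be a field and $\mathcal I$ an index set, and for each $i\in\mathcal I$ let $n_i,m_i$ be positive integers. Let $\mathcal A=\{A_{ij}\}_{i,j\in\mathcal I}$ and $\mathcal B=\{B_{ij}\}_{i,j\in\mathcal I}$ be families of matrices over $\mathbb F$, where $A_{ij}$ is $n_i\times n_j$ and $B_{ij}$ is $m_i\times m_j$. Assume that neither $\mathcal A$ nor $\mathcal B$ is strongly reducible in the coupled sense. Assume also that the digraphs $\mathcal D(\mathcal A)$ and $\mathcal D(\mathcal B)$ are strongly connected (this forces all the $n_i$ to have a common value $n$ and all the $m_i$ to have a common value $m$). Let $X_i$ be an $n\times m$ matrix over $\mathbb F$ for each $i\in\mathcal I$, and suppose $A_{ij}X_j=X_iB_{ij}$ for all $i,j\in\mathcal I$. Then either $X_i=0$ for all $i$, or $X_i$ is nonsingular for all $i$. In the latter case $m=n$. If $\mathcal A=\mathcal B$ is a family of complex matrices ($\mathbb F=\mathbb C$), then there is a scalar $\alpha$ such that $X_i=\alpha I_n$ for all $i$.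
   Context: The index set $\mathcal I$ may be finite or infinite. Nonsingular means square and invertible. Let $\mathcal A=\{A_{ij}\}_{i,j\in\mathcal I}$ with $A_{ij}$ an $n_i\times n_j$ matrix over $\mathbb F$, and let $\mathcal V_i=\mathbb F^{n_i}$. The family $\mathcal A$ is strongly reducible in the coupled sense if there exist subspaces $\mathcal U_i\subseteq\mathcal V_i$ ($i\in\mathcal I$), every one of which is a nonzero proper subspace of $\mathcal V_i$, such that $A_{ij}(\mathcal U_j)\subseteq\mathcal U_i$ for all $i,j\in\mathcal I$. The same definition applies to $\mathcal B$ with $\mathbb F^{m_i}$ in place of $\mathcal V_i$. A matrix has full column rank if its columns are linearly independent. The digraph $\mathcal D(\mathcal A)$ has vertices $\{v_i\}_{i\in\mathcal I}$, with a directed edge $(v_i,v_j)$ from $v_i$ to $v_j$ if and only if $A_{ij}$ has full column rank; $\mathcal D(\mathcal B)$ is defined similarly from the $B_{ij}$. A directed walk is a finite sequence of vertices $v_{i_1},\dots,v_{i_p}$ such that each $(v_{i_k},v_{i_{k+1}})$, $1\le k\le p-1$, is a directed edge. Two vertices $v,w$ are strongly connected if there is a directed walk from $v$ to $w$ and one from $w$ to $v$ (a single vertex counts as a walk from itself to itself). A digraph is strongly connected if each pair of its vertices is strongly connected. *)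

(* Defs.v *)
From HB Require Import structures.
From mathcomp Require Import all_boot all_order all_algebra.

Set Implicit Arguments.
Unset Strict Implicit.
Unset Printing Implicit Defensive.

Import GRing.Theory.
Local Open Scope ring_scope.

Section CoupledFamilies.

Variables (F : fieldType) (I : Type).

Definition mxfamily (n : I -> nat) : Type := forall i j : I, 'M[F]_(n i, n j).

(* For an empty index type this holds vacuously, so a family that is not
   strongly reducible has a nonempty index type. *)
Definition strongly_reducible (n : I -> nat) (A : mxfamily n) : Prop :=
  exists U : forall i : I, {vspace 'cV[F]_(n i)},
    (forall i, U i <> 0%VS /\ U i <> fullv) /\
    (forall i j (u : 'cV[F]_(n j)), u \in U j -> A i j *m u \in U i).

Definition full_column_rank (p q : nat) (M : 'M[F]_(p, q)) : bool :=
  free [seq col j M | j <- enum 'I_q].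

Definition digraph (n : I -> nat) (A : mxfamily n) : rel I :=
  fun i j => full_column_rank (A i j).

(* The dimensions p and q need not be syntactically equal, hence the cast. *)
Definition nonsingular (p q : nat) (M : 'M[F]_(p, q)) : Prop :=
  exists e : q = p, castmx (erefl p, e) M \in unitmx.

End CoupledFamilies.

(* A walk from v to w is v :: s with w as its last vertex; s may be empty. *)
Definition has_walk (V : Type) (e : rel V) (v w : V) : Prop :=
  exists2 s : seq V, path e v s & last v s = w.

Definition strongly_connected (V : Type) (e : rel V) : Prop :=
  forall v w : V, has_walk e v w /\ has_walk e w v.

(* Main.v *)
Require Import Defs.
From Stdlib Require Import Classical.
From HB Require Import structures.
From mathcomp Require Import all_boot all_order all_algebra.
From mathcomp Require Import complex reals.

Set Implicit Arguments.
Unset Strict Implicit.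
Unset Printing Implicit Defensive.

Import GRing.Theory.
Local Open Scope ring_scope.

(** The argument is Schur's lemma for coupled families.  Call subspaces [U i]
    invariant when [A i j] maps [U j] into [U i] for all [i] and [j].  If
    [(i, j)] is an edge of the digraph then [A i j] is injective, so an
    invariant family satisfies [\dim (U j) <= \dim (U i)]; along closed walks
    these inequalities force all the dimensions to agree
    ([strongly_connected_constant]).  Applied to the full spaces this makes all
    the sizes equal.  Applied to an arbitrary invariant family it shows that if
    one [U i] is zero, or full, then so are all of them; as strong
    irreducibility rules out that they are all nonzero and proper, only the two
    extreme families are invariant ([invariant_trivial]).

    When [A i j *m X j = X i *m B i j], the kernels of the [X i] are invariant
    under [B] and their images under [A].  So the kernels are all full, that is
    [X = 0], or they all vanish; in the second case the images are nonzero, hence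
    full, and every [X i] is bijective.

    Over an algebraically closed field with [A = B], take an eigenvalue [alpha]
    of a single [X i0].  The matrices [X i - alpha%:M] intertwine [A] with
    itself as well, and their kernel at [i0] is nonzero, so all their kernels
    are full, that is [X i = alpha%:M] for every [i]. *)

(** * Matrices acting on column vectors *)

Section ColumnAction.

Variable F : fieldType.

Definition colmap (p q : nat) (M : 'M[F]_(p, q)) : 'Hom('cV[F]_q, 'cV[F]_p) :=
  linfun (mulmx M).

Lemma colmapE p q (M : 'M[F]_(p, q)) u : colmap M u = M *m u.
Proof. by rewrite lfunE. Qed.

Lemma mem_lker_colmap p q (M : 'M[F]_(p, q)) u :
  (u \in lker (colmap M)) = (M *m u == 0).
Proof. by rewrite memv_ker colmapE. Qed.

Lemma dim_cV n : \dim {: 'cV[F]_n} = n.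
Proof. by rewrite dimvf /dim /= muln1. Qed.

Lemma full_column_rank_lker p q (M : 'M[F]_(p, q)) :
  full_column_rank M -> lker (colmap M) = 0%VS.
Proof.
move=> M_fcr.
have /freeP M_free : free [tuple col j M | j < q] := M_fcr.
apply/eqP; rewrite -subv0; apply/subvP => u.
rewrite mem_lker_colmap memv0 => /eqP Mu0.
suff u0 : forall j, u j 0 = 0.
  by apply/eqP/colP => j; rewrite u0 mxE.
apply: M_free; rewrite -[RHS]Mu0.
apply/colP => i; rewrite summxE mxE; apply: eq_bigr => j _.
by rewrite (nth_map j) ?size_enum_ord // nth_ord_enum !mxE mulrC.
Qed.

Lemma lker_colmap_full p q (M : 'M[F]_(p, q)) :
  lker (colmap M) = fullv -> M = 0.
Proof.
move=> kerM; apply/matrixP => i j.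
have: delta_mx j 0 \in lker (colmap M) by rewrite kerM memvf.
by rewrite mem_lker_colmap -colE => /eqP/colP/(_ i); rewrite !mxE.
Qed.

Lemma bijective_nonsingular p q (M : 'M[F]_(p, q)) :
  lker (colmap M) = 0%VS -> limg (colmap M) = fullv -> nonsingular M.
Proof.
move=> kerM imM.
have e : q = p.
  have := limg_ker_dim (colmap M) fullv.
  by rewrite capfv kerM imM dimv0 !dim_cV add0n.
exists e; case: p / e M kerM {imM} => M kerM; rewrite castmx_id.
rewrite -unitmx_tr -row_free_unit; apply: inj_row_free => v vM0.
have: v^T \in lker (colmap M).
  by rewrite mem_lker_colmap -[M]trmxK -trmx_mul vM0 trmx0.
by rewrite kerM memv0 => /eqP/(congr1 trmx); rewrite trmxK trmx0.
Qed.

End ColumnAction.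

(** * Dimensions along a strongly connected digraph *)

(** A walk from [v] to [w] gives [d w <= d v]; the return walk gives the
    converse. *)
Lemma strongly_connected_constant (V : Type) (e : rel V) (d : V -> nat) :
    strongly_connected e -> (forall v w, e v w -> (d w <= d v)%N) ->
  forall v w, d v = d w.
Proof.
move=> e_conn d_edge.
have d_walk v w : has_walk e v w -> (d w <= d v)%N.
  case=> s; elim: s v => [|x s IHs] v /= => [_ -> //|/andP[vx xs] sw].
  exact: leq_trans (IHs _ xs sw) (d_edge _ _ vx).
move=> v w; have [vw wv] := e_conn v w.
by apply/eqP; rewrite eqn_leq !d_walk.
Qed.

(** * Invariant families of subspaces *)

Section InvariantFamilies.

Variables (F : fieldType) (I : Type) (n : I -> nat) (A : mxfamily F n).

Definition invariant (U : forall i, {vspace 'cV[F]_(n i)}) : Prop :=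
  forall i j (u : 'cV[F]_(n j)), u \in U j -> A i j *m u \in U i.

Hypothesis A_irr : ~ strongly_reducible A.

(** Over an empty index type the zero family would be a strong reduction. *)
Lemma irreducible_inhabited : inhabited I.
Proof.
apply: NNPP => I_empty; apply: A_irr.
by exists (fun i => 0%VS); split=> i; case: I_empty.
Qed.

Hypothesis A_conn : strongly_connected (digraph A).

(** Across an edge [A i j] is injective, so [U j] embeds into [U i]. *)
Lemma invariant_dim_constant U :
  invariant U -> forall i j, \dim (U i) = \dim (U j).
Proof.
move=> U_inv; apply: (strongly_connected_constant A_conn) => i j edge.
have kerA := full_column_rank_lker edge.
have <- : \dim (colmap (A i j) @: U j) = \dim (U j).
  by apply: limg_dim_eq; rewrite kerA capv0.
apply: dimvS; apply/subvP => _ /memv_imgP[u Uu ->].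
by rewrite colmapE U_inv.
Qed.

Lemma size_constant : forall i j, n i = n j.
Proof.
move=> i j; rewrite -(dim_cV F (n i)) -(dim_cV F (n j)).
by apply: (@invariant_dim_constant (fun=> fullv)) => k l u _; apply: memvf.
Qed.

(** All [U i] have one dimension and sit in spaces of one size, so whether
    [U i] is zero, and whether it is full, does not depend on [i]; a family
    neither zero nor full would be a strong reduction. *)
Lemma invariant_trivial U :
  invariant U -> (forall i, U i = 0%VS) \/ (forall i, U i = fullv).
Proof.
move=> U_inv; have [i0] := irreducible_inhabited.
have dimU i := invariant_dim_constant U_inv i i0.
have zeroE i : (U i == 0%VS) = (\dim (U i0) == 0%N).
  by rewrite -dimv_eq0 dimU.
have fullE i : (U i == fullv) = (\dim (U i0) == n i0).
  have dim_le : (\dim (U i0) <= n i0)%N.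
    by rewrite (leq_trans (dimvS (subvf _))) ?dim_cV.
  by rewrite eqEdim subvf /= dimU dim_cV (size_constant i i0) eqn_leq dim_le.
case: (eqVneq (\dim (U i0)) 0%N) => [d0|dN0].
  by left=> i; apply/eqP; rewrite zeroE d0.
case: (eqVneq (\dim (U i0)) (n i0)) => [dn|dNn].
  by right=> i; apply/eqP; rewrite fullE dn.
case: A_irr; exists U; split=> // i.
by split; apply/eqP; rewrite ?zeroE ?fullE.
Qed.

End InvariantFamilies.

(** * Intertwiners *)

Section Intertwiners.

Variables (F : fieldType) (I : Type) (n m : I -> nat).
Variables (A : mxfamily F n) (B : mxfamily F m).
Variable X : forall i, 'M[F]_(n i, m i).
Hypothesis AX_XB : forall i j, A i j *m X j = X i *m B i j.

Lemma lker_invariant : invariant B (fun i => lker (colmap (X i))).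
Proof.
move=> i j u; rewrite !mem_lker_colmap => /eqP Xu0.
by rewrite mulmxA -AX_XB -mulmxA Xu0 mulmx0.
Qed.

Lemma limg_invariant : invariant A (fun i => limg (colmap (X i))).
Proof.
move=> i j _ /memv_imgP[u _ ->].
by rewrite colmapE mulmxA AX_XB -mulmxA -colmapE memv_img ?memvf.
Qed.

Hypotheses (A_irr : ~ strongly_reducible A) (B_irr : ~ strongly_reducible B).
Hypotheses (A_conn : strongly_connected (digraph A))
           (B_conn : strongly_connected (digraph B)).

(** The remaining combination, zero kernels with zero images, contradicts
    rank-nullity as the sources are nonzero spaces. *)
Lemma intertwiner_zero_or_nonsingular :
  (forall i, (0 < m i)%N) ->
  (forall i, X i = 0) \/ (forall i, nonsingular (X i)).
Proof.
move=> m_gt0.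
have [ker0|kerT] := invariant_trivial B_irr B_conn lker_invariant; last first.
  by left=> i; apply: lker_colmap_full (kerT i).
have [im0|imT] := invariant_trivial A_irr A_conn limg_invariant; last first.
  by right=> i; apply: bijective_nonsingular (ker0 i) (imT i).
have [i0] := irreducible_inhabited B_irr.
have := limg_ker_dim (colmap (X i0)) fullv.
rewrite capfv ker0 im0 !dimv0 dim_cV => /eqP.
by rewrite eq_sym eqn0Ngt m_gt0.
Qed.

End Intertwiners.

(** [eigenvalue] concerns row vectors, hence the passage to [M^T]. *)
Lemma closed_field_col_eigenvector (C : closedFieldType) (p : nat)
    (M : 'M[C]_p) :
  (0 < p)%N -> exists alpha, exists2 u : 'cV[C]_p, u != 0 & M *m u = alpha *: u.
Proof.
move=> p_gt0.
have /closed_rootP[alpha] : size (char_poly M^T) != 1.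
  by rewrite size_char_poly eqSS -lt0n.
rewrite -eigenvalue_root_char => /eigenvalueP[v vM vN0].
exists alpha, v^T; first by rewrite -trmx0 (inj_eq trmx_inj).
by rewrite -[M]trmxK -trmx_mul vM linearZ.
Qed.

(** Subtracting an eigenvalue of one [X i0] keeps the intertwining relation and
    makes one kernel nonzero, so the kernels of the whole family are full. *)
Lemma self_intertwiner_scalar (C : closedFieldType) (I : Type) (n : I -> nat)
    (A : mxfamily C n) (X : forall i, 'M[C]_(n i)) :
    (forall i, (0 < n i)%N) ->
    ~ strongly_reducible A -> strongly_connected (digraph A) ->
    (forall i j, A i j *m X j = X i *m A i j) ->
  exists alpha, forall i, X i = alpha%:M.
Proof.
move=> n_gt0 A_irr A_conn AX_XA.
have [i0] := irreducible_inhabited A_irr.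
have [alpha [u uN0 Xu]] := closed_field_col_eigenvector (X i0) (n_gt0 i0).
exists alpha.
have AY_YA i j : A i j *m (X j - alpha%:M) = (X i - alpha%:M) *m A i j.
  by rewrite mulmxBr mulmxBl AX_XA mul_mx_scalar mul_scalar_mx.
have [ker0|kerT] := invariant_trivial A_irr A_conn (lker_invariant AY_YA).
  have: u \in lker (colmap (X i0 - alpha%:M)).
    by rewrite mem_lker_colmap mulmxBl Xu mul_scalar_mx subrr.
  by rewrite ker0 memv0 (negPf uN0).
by move=> i; apply/eqP; rewrite -subr_eq0 (lker_colmap_full (kerT i)).
Qed.

Theorem theorem5p1 :
  (forall (F : fieldType) (I : Type) (n_ m_ : I -> nat)
      (n_gt0 : forall i, (0 < n_ i)%N) (m_gt0 : forall i, (0 < m_ i)%N)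
      (A : mxfamily F n_) (B : mxfamily F m_)
      (A_irr : ~ strongly_reducible A) (B_irr : ~ strongly_reducible B)
      (A_conn : strongly_connected (digraph A))
      (B_conn : strongly_connected (digraph B)),
    exists n m : nat,
      [/\ forall i, n_ i = n,
          forall i, m_ i = m
        & forall (X : forall i, 'M[F]_(n_ i, m_ i))
            (AX_XB : forall i j, A i j *m X j = X i *m B i j),
          (forall i, X i = 0) \/ ((forall i, nonsingular (X i)) /\ m = n)])
  /\
  (forall (R : realType) (I : Type) (n_ : I -> nat)
      (n_gt0 : forall i, (0 < n_ i)%N)
      (A : mxfamily (complex R) n_)
      (A_irr : ~ strongly_reducible A)
      (A_conn : strongly_connected (digraph A))
      (X : forall i, 'M[complex R]_(n_ i, n_ i))
      (AX_XA : forall i j, A i j *m X j = X i *m A i j),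
    exists alpha : complex R, forall i, X i = alpha%:M).
Proof.
split=> [F I n m _ m_gt0 A B A_irr B_irr A_conn B_conn|R I n n_gt0 A A_irr
         A_conn X AX_XA].
  have [i0] := irreducible_inhabited A_irr.
  exists (n i0), (m i0); split=> [i|i|X AX_XB].
  - exact: (size_constant A_conn).
  - exact: (size_constant B_conn).
  have [X0|X_ns] := intertwiner_zero_or_nonsingular AX_XB A_irr B_irr A_conn
                      B_conn m_gt0; [by left | right].
  by split=> //; case: (X_ns i0).
exact: self_intertwiner_scalar n_gt0 A_irr A_conn AX_XA.
Qed.
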